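(* For fixed $d>3$ there is a constant $c>0$, independent of $n$ and $s$, such that for every $s\in(0,1]$ and every initial position $x(0)$ with $\sum_i d\,(x_i(0)-\mu)^2\le 1$ (where $\mu=\frac1n\sum_ix_i(0)$), the random averaging system satisfies $\mathbb{E}\,E_s\le c/s$.
   Context: Fix an integer $d>3$ and $n>d$. In a random averaging system, for each $t\ge0$ the graph $G_t$ is chosen independently and uniformly at random among all simple $(d-1)$-regular graphs on $[n]$, and then a self-loop is added at every vertex. Let $M_t$ be the resulting $0/1$ adjacency matrix (all row sums equal to $d$). Set $P_t=M_t/d$ and $x(t+1)=P_tx(t)$. At time $t$, each edge $\{i,j\}$ of $G_t$ with $i\ne j$ is embedded as the closed interval with endpoints $x_i(t),x_j(t)$. The union of these intervals is a disjoint union of closed intervals (blocks) with lengths $l_1(t),\dots,l_{k_t}(t)$. The $s$-energy is $E_s=\sum_{t\ge0}\sum_il_i(t)^s$; it is a random variable. *)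

(* Defs.v *)
From HB Require Import structures.
From mathcomp Require Import all_boot all_order all_algebra.
From mathcomp Require Import all_classical all_reals all_analysis.
Set Implicit Arguments. Unset Strict Implicit. Unset Printing Implicit Defensive.
Import Order.TTheory GRing.Theory Num.Theory.
Import numFieldNormedType.Exports.
Local Open Scope classical_set_scope.
Local Open Scope ring_scope.

(* A graph on [n] = 'I_n is given by its set of ordered pairs (i,j) such that
   {i,j} is an edge (both orientations present). *)
Definition graph (n : nat) := {set 'I_n * 'I_n}.

Definition simple_regular (n k : nat) (E : graph n) : bool :=
  [forall i : 'I_n, (i, i) \notin E] &&
  [forall i : 'I_n, forall j : 'I_n, ((i, j) \in E) == ((j, i) \in E)] &&
  [forall i : 'I_n, #|[set j : 'I_n | (i, j) \in E]| == k].

Definition reg_graphs (n d : nat) : {set graph n} :=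
  [set E : graph n | simple_regular d.-1 E].

Definition adj_loop (R : realType) (n : nat) (E : graph n) : 'M[R]_n :=
  \matrix_(i, j) (((i == j) || ((i, j) \in E)) : bool)%:R.

Definition avg_matrix (R : realType) (n d : nat) (E : graph n) : 'M[R]_n :=
  (d%:R)^-1 *: adj_loop R E.

Fixpoint traj (R : realType) (n d : nat) (gs : nat -> graph n)
    (x0 : 'cV[R]_n) (t : nat) : 'cV[R]_n :=
  match t with
  | 0 => x0
  | t'.+1 => avg_matrix R d (gs t') *m traj d gs x0 t'
  end.

Definition edge_union (R : realType) (n : nat) (E : graph n) (x : 'cV[R]_n)
    : set R :=
  \bigcup_(e in [set e | e \in E])
    `[Num.min (x e.1 0) (x e.2 0), Num.max (x e.1 0) (x e.2 0)]%classic.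

Definition blocks (R : realType) (n : nat) (E : graph n) (x : 'cV[R]_n)
    : set (set R) :=
  [set connected_component (edge_union E x) y | y in edge_union E x].

Definition block_energy (R : realType) (n : nat) (s : R) (E : graph n)
    (x : 'cV[R]_n) : R :=
  \sum_(B \in blocks E x) (sup B - inf B) `^ s.

Definition partial_energy (R : realType) (n d : nat) (s : R)
    (gs : nat -> graph n) (x0 : 'cV[R]_n) (T : nat) : R :=
  \sum_(t < T.+1) block_energy s (gs t) (traj d gs x0 t).

(* expectation of the truncated energy: (G_0,...,G_T) is uniform on
   reg_graphs^(T+1) (independent uniform choices) *)
Definition exp_partial_energy (R : realType) (n d : nat) (s : R)
    (x0 : 'cV[R]_n) (T : nat) : R :=
  (\sum_(gs : {ffun 'I_T.+1 -> graph n} |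
          [forall t, gs t \in reg_graphs n d])
     partial_energy d s
       (fun t => if (t < T.+1)%N then gs (inord t) else finset.set0) x0 T)
  / (#|reg_graphs n d| ^ T.+1)%:R.

(* E[E_s] = sup_T E[truncated energy] (monotone convergence) *)
Definition expected_energy (R : realType) (n d : nat) (s : R)
    (x0 : 'cV[R]_n) : \bar R :=
  ereal_sup [set (exp_partial_energy d s x0 T)%:E | T in [set: nat]].

Definition mean (R : realType) (n : nat) (x : 'cV[R]_n) : R :=
  (n%:R)^-1 * \sum_(i < n) x i 0.

(* Main.v *)
Require Import Defs.
From HB Require Import structures.
From mathcomp Require Import all_boot all_order all_algebra all_fingroup.
From mathcomp Require Import all_classical all_reals all_analysis.
From mathcomp Require Import zify ring lra.
Set Implicit Arguments. Unset Strict Implicit. Unset Printing Implicit Defensive.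
Import Order.TTheory GRing.Theory Num.Theory.
Import numFieldNormedType.Exports.
Local Open Scope ring_scope.

(** A block is determined by its rightmost vertex [i], and then no edge leaves
the set [{j | x_j <= x_i}].  For a fixed proper nonempty set of vertices, an
edge-switching injection shows that a uniform regular graph has no edge leaving
it with probability at most [2/n]; there are at most [n] such sets, so the
expected number of blocks is at most [3] whatever the positions are.  Each
block has length at most [2 sqrt V], where [V] is the sum of squared deviations
from the mean.  The law of the graph is invariant under relabelling, so the
average of [P^T P] is [a I + b (J - I)] with [a = 1/d] and [b >= 0], and hence
[V] shrinks in expectation by a factor at least [d] at every step.  By Jensen's
inequality [V^(s/2)] shrinks by [d^(-s/2)], and the geometric series is
[O(1/s)]. *)

(** * Regular graphs, closed vertex sets and edge switching *)

Lemma simple_regularP (n k : nat) (E : graph n) :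
  reflect [/\ forall i, (i, i) \notin E,
              forall i j, ((i, j) \in E) = ((j, i) \in E)
            & forall i, #|[set j | (i, j) \in E]%SET| = k]
          (simple_regular k E).
Proof.
have cE i : #|[set j | (i, j) \in E]%classic| = #|[set j | (i, j) \in E]%SET|.
  by apply: eq_card => j; rewrite inE; apply/idP/idP; rewrite inE.
apply: (iffP andP) => [[/andP[/forallP h1 /forallP h2] /forallP h3]|[h1 h2 h3]].
  split=> // [i j|i]; last by rewrite -cE; exact/eqP/h3.
  by apply/eqP; move/forallP: (h2 i).
split; last by apply/forallP => i; rewrite cE h3.
apply/andP; split; first exact/forallP.
by apply/forallP => i; apply/forallP => j; rewrite h2.
Qed.

Definition edge_closed (n : nat) (S : {set 'I_n}) (E : graph n) : bool :=
  [forall e, (e \in E) ==> ((e.1 \in S) == (e.2 \in S))].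

Lemma edge_closedP (n : nat) (S : {set 'I_n}) (E : graph n) :
  reflect (forall i j, (i, j) \in E -> (i \in S) = (j \in S)) (edge_closed S E).
Proof.
apply: (iffP forallP) => [h i j ij|h [i j]].
  by move: (h (i, j)); rewrite ij => /eqP.
by apply/implyP => ij /=; rewrite (h i j ij).
Qed.

Lemma edge_closedC (n : nat) (S : {set 'I_n}) (E : graph n) :
  edge_closed (~: S)%SET E = edge_closed S E.
Proof.
apply/edge_closedP/edge_closedP => h i j /h; rewrite !inE; last by move=> ->.
exact: negb_inj.
Qed.

(** The classical degree-preserving switch: edges [ab], [ce] are traded for [ac], [be]. Eight
    ordered pairs occur because a graph stores both orientations. *)
Definition switch (n : nat) (E : graph n) (a b c e : 'I_n) : graph n :=
  [set p | (p \notin [:: (a, b); (b, a); (c, e); (e, c)]) &&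
           ((p \in [:: (a, c); (c, a); (b, e); (e, b)]) || (p \in E))]%SET.

Definition switchable (n : nat) (E : graph n) (a b c e : 'I_n) : Prop :=
  [/\ uniq [:: a; b; c; e], (a, b) \in E, (c, e) \in E, (a, c) \notin E
    & (b, e) \notin E].

(** This symmetry and the next let any of the four vertices play the role of [a], so that degrees
    need only be checked there. *)
Lemma switch_flip (n : nat) (E : graph n) (a b c e : 'I_n) :
  switch E b a e c = switch E a b c e.
Proof. by apply/setP => p; rewrite !inE; do 8 case: (p == _). Qed.

Lemma switch_swap (n : nat) (E : graph n) (a b c e : 'I_n) :
  switch E c e a b = switch E a b c e.
Proof. by apply/setP => p; rewrite !inE; do 8 case: (p == _). Qed.

Lemma switchable_flip (n k : nat) (E : graph n) (a b c e : 'I_n) :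
  simple_regular k E -> switchable E a b c e -> switchable E b a e c.
Proof.
case/simple_regularP=> _ sE _ [u ab ce ac be].
split=> //; [|by rewrite sE|by rewrite sE].
move: u => /=; rewrite !inE (eq_sym b a) (eq_sym e c).
by do 6 case: (_ == _).
Qed.

Lemma switchable_swap (n k : nat) (E : graph n) (a b c e : 'I_n) :
  simple_regular k E -> switchable E a b c e -> switchable E c e a b.
Proof.
case/simple_regularP=> _ sE _ [u ab ce ac be].
split=> //; [|by rewrite sE|by rewrite sE].
move: u => /=; rewrite !inE (eq_sym c a) (eq_sym c b) (eq_sym e a) (eq_sym e b).
by do 6 case: (_ == _).
Qed.

(** The neighbour [b] of [a] is removed and the non-neighbour [c] is added. *)
Lemma card_switch_nbr (n k : nat) (E : graph n) (a b c e : 'I_n) :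
  simple_regular k E -> switchable E a b c e ->
  #|[set j | (a, j) \in switch E a b c e]%SET| = k.
Proof.
case/simple_regularP=> _ _ dE [u ab ce ac be].
have -> : [set j | (a, j) \in switch E a b c e]%SET =
          (c |: [set j | (a, j) \in E] :\ b)%SET.
  move: u => /=; rewrite !inE !negb_or andbT.
  case/and3P=> /and3P[n1 n2 n3] /andP[n4 n5] n6.
  apply/setP => j; rewrite !inE !xpair_eqE !eqxx (negbTE n1) (negbTE n2) (negbTE n3) /= !orbF.
  by case: (altP (j =P b)) => [->|] //=; rewrite (negbTE n4).
rewrite cardsU1 !inE (negbTE ac) andbF /= -(dE a).
by rewrite [RHS](cardsD1 b) !inE ab.
Qed.

Lemma simple_regular_switch (n k : nat) (E : graph n) (a b c e : 'I_n) :
  simple_regular k E -> switchable E a b c e ->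
  simple_regular k (switch E a b c e).
Proof.
move=> rE sw; have /simple_regularP[iE sE dE] := rE.
have [u ab ce ac be] := sw.
have sw1 := switchable_flip rE sw.
have sw2 := switchable_swap rE sw.
have sw3 := switchable_flip rE sw2.
apply/simple_regularP; split.
- move=> i; rewrite !inE !xpair_eqE (negbTE (iE i)) orbF.
  move: u => /=; rewrite !inE !negb_or andbT.
  case/and3P=> /and3P[n1 n2 n3] /andP[n4 n5] n6.
  case: (altP (i =P a)) => [->|_] /=; first by rewrite (negbTE n2) !andbF (negbTE n1) (negbTE n3) /= ?andbF.
  rewrite ?andbF /=.
  case: (altP (i =P b)) => [->|_] /=; first by rewrite (negbTE n5) ?andbF.
  by rewrite ?andbF.
- move=> i j; rewrite !inE !xpair_eqE sE.
  rewrite ![(i == _) && _]andbC.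
  by do 4 (case: (j == _); case: (i == _)).
- move=> i; case: (altP (i =P a)) => [->|na]; first exact: card_switch_nbr rE sw.
  case: (altP (i =P b)) => [->|nb].
    by rewrite -switch_flip; exact: card_switch_nbr rE sw1.
  case: (altP (i =P c)) => [->|nc].
    by rewrite -switch_swap; exact: card_switch_nbr rE sw2.
  case: (altP (i =P e)) => [->|ne].
    by rewrite -switch_swap -switch_flip; exact: card_switch_nbr rE sw3.
  rewrite -(dE i); apply: eq_card => j.
  by rewrite !inE !xpair_eqE (negbTE na) (negbTE nb) (negbTE nc) (negbTE ne).
Qed.

(** A fixed choice of neighbour makes the switch a function of the graph and two vertices. The
    default [v] occurs only at isolated vertices. *)
Definition nbr (n : nat) (E : graph n) (v : 'I_n) : 'I_n :=
  odflt v [pick w | (v, w) \in E].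

Lemma nbrP (n k : nat) (E : graph n) (v : 'I_n) :
  (0 < k)%N -> simple_regular k E -> (v, nbr E v) \in E.
Proof.
move=> k0 /simple_regularP[_ _ dE]; rewrite /nbr; case: pickP => //= vE.
have: #|[set j | (v, j) \in E]%SET| = 0%N by apply: eq_card0 => w; rewrite inE.
by rewrite dE => k00; rewrite k00 in k0.
Qed.

Lemma switch_crossing (n : nat) (S : {set 'I_n}) (E : graph n)
    (a b c e i j : 'I_n) :
  edge_closed S E -> a \in S -> b \in S -> c \notin S -> e \notin S ->
  i \in S -> j \notin S ->
  ((i, j) \in switch E a b c e) = ((i, j) \in [:: (a, c); (b, e)]).
Proof.
move=> /edge_closedP iE aS bS cS eS iS jS.
have neq u v : u \in S -> v \notin S -> (u == v) = false.
  by move=> uS vS; apply/eqP => uv; rewrite uv (negbTE vS) in uS.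
have ijE : ((i, j) \in E) = false.
  by apply/negP => /iE; rewrite iS (negbTE jS).
rewrite !inE !xpair_eqE ijE (neq i c) // (neq i e) //.
rewrite (eq_sym j a) (eq_sym j b) (neq a j) // (neq b j) //.
by rewrite !andbF /= !orbF.
Qed.

(** The crossing edge at [a] reveals [c], and the other crossing edge reveals [b] and [e]. The
    switch can then be undone: the eight touched pairs have known status in both graphs, and the
    remaining pairs are unchanged. *)
Lemma switch_inj (n : nat) (S : {set 'I_n}) (E E' : graph n)
    (a b c e b' c' e' : 'I_n) :
  edge_closed S E -> edge_closed S E' -> a \in S -> b \in S -> b' \in S ->
  c \notin S -> e \notin S -> c' \notin S -> e' \notin S ->
  switchable E a b c e -> switchable E' a b' c' e' ->
  (forall i j, ((i, j) \in E) = ((j, i) \in E)) ->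
  (forall i j, ((i, j) \in E') = ((j, i) \in E')) ->
  switch E a b c e = switch E' a b' c' e' -> E = E' /\ c = c'.
Proof.
move=> iE iE' aS bS b'S cS eS c'S e'S sw sw' sE sE' eqH.
have nab : (b == a) = false.
  by case: sw => /= /and4P[]; rewrite !inE eq_sym => /norP[/negbTE].
have nab' : (a == b') = false.
  by case: sw' => /= /and4P[]; rewrite !inE => /norP[/negbTE].
have cc' : c = c'.
  have : (a, c) \in switch E a b c e.
    by rewrite (switch_crossing iE) // !inE eqxx.
  rewrite eqH (switch_crossing iE') // !inE !xpair_eqE nab' orbF.
  by case/andP => _ /eqP.
have [bb' ee'] : b = b' /\ e = e'.
  have : (b, e) \in switch E a b c e.
    by rewrite (switch_crossing iE) // !inE eqxx orbT.
  rewrite eqH (switch_crossing iE') // !inE !xpair_eqE nab /=.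
  by case/andP => /eqP ? /eqP.
subst b' c' e'; split=> //; apply/setP => p.
have := congr1 (fun H : graph n => p \in H) eqH; rewrite /switch /= !inE.
case: sw sw' => _ ab ce ac be [_ ab' ce' ac' be'].
case: (altP (p =P (a, b))) => [->|_]; first by rewrite ab ab'.
case: (altP (p =P (b, a))) => [->|_]; first by rewrite sE sE' ab ab'.
case: (altP (p =P (c, e))) => [->|_]; first by rewrite ce ce'.
case: (altP (p =P (e, c))) => [->|_]; first by rewrite sE sE' ce ce'.
case: (altP (p =P (a, c))) => [->|_]; first by rewrite (negbTE ac) (negbTE ac').
case: (altP (p =P (c, a))) => [->|_].
  by rewrite sE sE' (negbTE ac) (negbTE ac').
case: (altP (p =P (b, e))) => [->|_]; first by rewrite (negbTE be) (negbTE be').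
by case: (altP (p =P (e, b))) => [->|_] //; rewrite sE sE' (negbTE be) (negbTE be').
Qed.

(* Switching the edge at a fixed [a] of [S] with the edge at any [c] outside
   [S] produces a graph whose only crossing edges are the two new ones, hence
   the original graph and [c] can be read off the result. *)
Lemma card_edge_closed_le (n k : nat) (S : {set 'I_n}) (a : 'I_n) :
  (0 < k)%N -> a \in S ->
  (#|[set E : graph n | simple_regular k E & edge_closed S E]%SET| * #|~: S|
     <= #|[set E : graph n | simple_regular k E]%SET|)%N.
Proof.
move=> k0 aS; rewrite -cardsX.
pose f (p : graph n * 'I_n) := switch p.1 a (nbr p.1 a) p.2 (nbr p.1 p.2).
have sw E c : simple_regular k E -> edge_closed S E -> c \notin S ->
    [/\ switchable E a (nbr E a) c (nbr E c), nbr E a \in S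
      & nbr E c \notin S].
  move=> rE /edge_closedP iE cS; have /simple_regularP[nE sE dE] := rE.
  have ab := nbrP a k0 rE; have ce := nbrP c k0 rE.
  have bS : nbr E a \in S by rewrite -(iE _ _ ab).
  have eS : nbr E c \notin S by rewrite -(iE _ _ ce).
  split=> //.
  have neq u v : u \in S -> v \notin S -> (u == v) = false.
    by move=> uS vS; apply/eqP => uv; rewrite uv (negbTE vS) in uS.
  split=> //.
  - rewrite /= !inE (neq a c) // (neq a (nbr E c)) // (neq (nbr E a) c) //.
    rewrite (neq (nbr E a) (nbr E c)) //= !orbF !andbT.
    apply/andP; split; apply/eqP => h.
      by move: ab; rewrite -h (negbTE (nE _)).
    by move: ce; rewrite -h (negbTE (nE _)).
  - by apply/negP => /iE; rewrite aS (negbTE cS).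
  - by apply/negP => /iE; rewrite bS (negbTE eS).
rewrite -(@card_in_imset _ _ f).
  apply/subset_leq_card/fintype.subsetP => H /imsetP[[E c]].
  rewrite !inE /= => /andP[/andP[rE iE] cS] ->.
  by apply: simple_regular_switch => //; case: (sw E c rE iE cS).
move=> [E c] [E' c']; rewrite !inE /=.
move=> /andP[/andP[rE iE] cS] /andP[/andP[rE' iE'] c'S]; rewrite /f /= => eqH.
have [s1 b1 e1] := sw E c rE iE cS; have [s2 b2 e2] := sw E' c' rE' iE' c'S.
have /simple_regularP[_ sE _] := rE; have /simple_regularP[_ sE' _] := rE'.
by have [-> ->] := switch_inj iE iE' aS b1 b2 cS e1 c'S e2 s1 s2 sE sE' eqH.
Qed.

(** The preceding count is applied to [S] and to its complement, which are closed in the same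
    graphs. The two bounds are added, the sizes summing to [n]. *)
Lemma card_edge_closed_bound (n k : nat) (S : {set 'I_n}) :
  (0 < k)%N -> S != finset.set0 -> S != [set: 'I_n]%SET ->
  (#|[set E : graph n | simple_regular k E & edge_closed S E]%SET| * n
     <= 2 * #|[set E : graph n | simple_regular k E]%SET|)%N.
Proof.
move=> k0 /set0Pn[a aS] ST.
have /set0Pn[b bS] : (~: S)%SET != finset.set0.
  by apply: contra ST => /eqP h; rewrite -(finset.setCK S) h finset.setC0.
have h1 := card_edge_closed_le k0 aS.
have h2 := card_edge_closed_le k0 bS.
have eqA : [set E : graph n | simple_regular k E & edge_closed (~: S) E]%SET =
           [set E : graph n | simple_regular k E & edge_closed S E]%SET.
  by apply/setP => E; rewrite !inE edge_closedC.
rewrite eqA finset.setCK in h2.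
by rewrite -[X in (_ * X)%N](card_ord n) -(cardsC S) mulnDr mul2n -addnn leq_add.
Qed.

(** * Blocks and closed cuts *)

Definition lower_set (R : realType) (n : nat) (x : 'cV[R]_n) (i : 'I_n) :
    {set 'I_n} := [set j | x j 0 <= x i 0]%SET.

(** Counting sets rather than vertices merges tied positions; in particular the full vertex set,
    closed in every graph, counts only once. *)
Definition closed_cuts (R : realType) (n : nat) (E : graph n)
    (x : 'cV[R]_n) : {set {set 'I_n}} :=
  [set S in [set lower_set x i | i : 'I_n]%SET | edge_closed S E]%SET.

Lemma edge_component (R : realType) (n : nat) (E : graph n) (x : 'cV[R]_n)
    (i j : 'I_n) (y z : R) : (i, j) \in E ->
  y \in `[Num.min (x i 0) (x j 0), Num.max (x i 0) (x j 0)] ->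
  z \in `[Num.min (x i 0) (x j 0), Num.max (x i 0) (x j 0)] ->
  connected_component (edge_union E x) y z.
Proof.
set U := edge_union E x.
move=> ijE yI zI.
pose I := `[Num.min (x i 0) (x j 0), Num.max (x i 0) (x j 0)]%classic.
suff : (I `<=` connected_component U y)%classic by apply.
apply: connected_component_max; [exact: yI | | exact: segment_connected].
by move=> w wI; exists (i, j); [exact: ijE | exact: wI].
Qed.

Lemma mem_edge_segment (R : realType) (n : nat) (x : 'cV[R]_n) (i j : 'I_n) :
  (x i 0 \in `[Num.min (x i 0) (x j 0), Num.max (x i 0) (x j 0)]) /\
  (x j 0 \in `[Num.min (x i 0) (x j 0), Num.max (x i 0) (x j 0)]).
Proof. by rewrite !in_itv /= !ge_min !le_max !lexx ?orbT. Qed.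

(** The witness is a vertex of largest position in the block: an edge crossing its cut would put a
    vertex further right into the same block. *)
Lemma block_closed_cut (R : realType) (n : nat) (E : graph n) (x : 'cV[R]_n)
    (y : R) : edge_union E x y ->
  exists2 i, connected_component (edge_union E x) y (x i 0) & edge_closed (lower_set x i) E.
Proof.
set U := edge_union E x => Uy; have [[i0 j0] /= i0j0 yI] := Uy.
have Bi0 : connected_component U y (x i0 0).
  by apply: edge_component i0j0 yI _; case: (mem_edge_segment x i0 j0).
have Pi0 : `[< connected_component U y (x i0 0) >] by apply/asboolP.
case: (@arg_maxP _ _ _ i0 (fun i => `[< connected_component U y (x i 0) >])
  (fun i => x i 0) Pi0) => i /asboolP Bi imax.
exists i => //.
have inB j k : (j, k) \in E -> (connected_component U y (x j 0) <->
                                connected_component U y (x k 0)).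
  move=> jk; have [m1 m2] := mem_edge_segment x j k; split.
    by move/same_connected_component => ->; exact: edge_component jk m1 m2.
  by move/same_connected_component => ->; exact: edge_component jk m2 m1.
have imax' k : connected_component U y (x k 0) -> x k 0 <= x i 0.
  by move=> h; apply: imax; apply/asboolP.
(* an edge leaving the cut would contain [x i] in its segment *)
have sub j k : (j, k) \in E -> Num.min (x j 0) (x k 0) <= x i 0 ->
    Num.max (x j 0) (x k 0) <= x i 0.
  move=> jk mini; rewrite leNgt; apply/negP => maxi.
  have iI : x i 0 \in `[Num.min (x j 0) (x k 0), Num.max (x j 0) (x k 0)].
    by rewrite in_itv /= mini ltW.
  have [m1 m2] := mem_edge_segment x j k.
  move: maxi; rewrite lt_max => /orP[]; rewrite ltNge => /negP; apply;
    apply: imax'; rewrite (same_connected_component Bi).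
    exact: edge_component jk iI m1.
  exact: edge_component jk iI m2.
apply/edge_closedP => j k jk; have := sub j k jk; rewrite !inE ge_min ge_max.
by case: (_ <= _); case: (_ <= _) => //= /(_ isT).
Qed.

Lemma block_energy_le (R : realType) (n : nat) (E : graph n) (x : 'cV[R]_n)
    (s lo hi : R) : 0 < s ->
  (forall i, lo <= x i 0 <= hi) ->
  block_energy s E x <= #|closed_cuts E x|%:R * (hi - lo) `^ s.
Proof.
set U := edge_union E x => s0 xb.
(* [phi] sends closed cuts onto blocks. The picked [i] is immaterial, since vertices with equal
   lower sets have equal positions. *)
pose phi (S : {set 'I_n}) : set R :=
  if [pick i | lower_set x i == S] is Some i then connected_component U (x i 0)
  else classical_sets.set0.
have phiP B : blocks E x B -> exists2 A, A \in closed_cuts E x & phi A = B.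
  move=> [y Uy <-]; have [i Bi iso] := block_closed_cut Uy.
  exists (lower_set x i); first by rewrite inE iso andbT; exact: imset_f.
  rewrite /phi; case: pickP => [j /eqP ji|/(_ i)]; last by rewrite eqxx.
  rewrite (same_connected_component Bi); congr (connected_component U _).
  have : j \in lower_set x i by rewrite -ji inE.
  have : i \in lower_set x j by rewrite ji inE.
  by rewrite !inE => ij ji'; apply/eqP; rewrite eq_le ij ji'.
pose r := [seq phi A | A <- enum (closed_cuts E x)].
have sub : {subset blocks E x <= r}.
  move=> B; rewrite inE => /phiP[S SK <-]; apply: map_f.
  by rewrite mem_enum.
(* Finiteness turns the sum over blocks into an ordinary finite sum. *)
have fin : finite_set (blocks E x).
  apply: (@sub_finite_set _ _ [set` r]%classic) => [B bB|]; last exact: finite_seq.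
  by apply: sub; rewrite inE.
have Ub z : U z -> lo <= z <= hi.
  move=> [[i j] _] /=; rewrite in_itv /= => /andP[h1 h2].
  have /andP[a1 a2] := xb i; have /andP[b1 b2] := xb j.
  apply/andP; split; first by apply: le_trans h1; rewrite le_min a1.
  by apply: le_trans h2 _; rewrite ge_max a2.
have len B : blocks E x B -> (sup B - inf B) `^ s <= (hi - lo) `^ s.
  move=> [y Uy <-]; set B' := connected_component U y.
  have By : B' y by apply: connected_component_refl.
  have BU : (B' `<=` U)%classic by exact: connected_component_sub.
  have ubB : ubound B' hi by move=> z /BU/Ub/andP[].
  have lbB : lbound B' lo by move=> z /BU/Ub/andP[].
  have h1 : sup B' <= hi by apply: ge_sup => //; exists y.
  have h2 : lo <= inf B' by apply: lb_le_inf => //; exists y.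
  have h3 : inf B' <= y by apply: ge_inf => //; exists lo.
  have h4 : y <= sup B' by apply: ub_le_sup => //; exists hi.
  have h5 : 0 <= sup B' - inf B' by rewrite subr_ge0 (le_trans h3).
  have h6 : sup B' - inf B' <= hi - lo by exact: lerB.
  exact: (ge0_ler_powR (ltW s0) h5 (le_trans h5 h6) h6).
rewrite /block_energy fsbig_finite //=.
rewrite big_seq; apply: (le_trans (ler_sum _ (G := fun=> (hi - lo) `^ s) _)).
  by move=> B; rewrite in_fset_set // inE => /len.
rewrite -big_seq big_const_seq count_predT iter_addr addr0 -[leLHS]mulr_natl.
apply: ler_wpM2r; first exact: powR_ge0.
rewrite ler_nat cardE -(size_map phi); apply: uniq_leq_size.
  exact: finmap.fset_uniq.
by move=> B; rewrite in_fset_set // => /sub.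
Qed.

(** Double counting of pairs of a graph and a closed lower set: at most [n] proper sets give at most
    a fraction [2/n] of the graphs each, and the full set gives all of them. *)
Lemma sum_card_closed_cuts (R : realType) (n d : nat) (x : 'cV[R]_n) :
  (1 < d)%N -> (0 < n)%N ->
  (\sum_(E in reg_graphs n d) #|closed_cuts E x| <= 3 * #|reg_graphs n d|)%N.
Proof.
move=> d1 n0; set T := [set lower_set x i | i : 'I_n]%SET.
set N := #|reg_graphs n d|.
pose A0 (A : {set 'I_n}) :=
  #|[set E : graph n | simple_regular d.-1 E & edge_closed A E]%SET|.
have -> : (\sum_(E in reg_graphs n d) #|closed_cuts E x| =
           \sum_(A in T) A0 A)%N.
  under eq_bigr do rewrite -sum1_card.
  rewrite (exchange_big_dep (mem T)) /=; last by move=> E A _; rewrite inE => /andP[].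
  apply: eq_bigr => A AT; rewrite /A0 -sum1_card; apply: eq_bigl => E.
  by rewrite !inE AT.
(* Everything is multiplied by [n] to stay in the naturals; the last term pays for the full vertex
   set. *)
have A0_le A : A \in T -> (A0 A * n <= 2 * N + (A == [set: 'I_n]%SET) * (n * N))%N.
  move=> AT; case: (altP (A =P [set: 'I_n]%SET)) => [->|AnT].
    rewrite mul1n mulnC (leq_trans _ (leq_addl _ _)) // leq_mul2l; apply/orP; right.
    by apply/subset_leq_card/fintype.subsetP => E; rewrite !inE => /andP[].
  rewrite mul0n addn0; apply: card_edge_closed_bound => //.
    by rewrite -subn1 subn_gt0.
  by case/imsetP: AT => i _ ->; apply/set0Pn; exists i; rewrite inE.
rewrite -(leq_pmul2r n0) big_distrl /=.
apply: (leq_trans (leq_sum _ A0_le)).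
rewrite big_split /= sum_nat_const -big_distrl /=.
have -> : (3 * N * n = n * (2 * N) + 1 * (n * N))%N by lia.
apply: leq_add; rewrite leq_mul2r; apply/orP; right.
  by rewrite (leq_trans (leq_imset_card _ _)) // cardT size_enum_ord.
rewrite -(card1 [set: 'I_n]%SET) -sum1_card [leqRHS]big_mkcond /=.
rewrite big_mkcond; apply: leq_sum => A _; rewrite !inE.
by case: (A \in T); case: (A == _).
Qed.

(** * Squared deviations under one averaging step *)

Definition sqdev (R : realType) (n : nat) (x : 'cV[R]_n) : R :=
  \sum_i (x i 0 - mean x) ^+ 2.

Lemma sqdev_ge0 (R : realType) (n : nat) (x : 'cV[R]_n) : 0 <= sqdev x.
Proof. by apply: sumr_ge0 => i _; exact: sqr_ge0. Qed.

Lemma norm_dev_le (R : realType) (n : nat) (x : 'cV[R]_n) (i : 'I_n) :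
  `|x i 0 - mean x| <= Num.sqrt (sqdev x).
Proof.
rewrite -sqrtr_sqr ler_wsqrtr // /sqdev (bigD1 i) //= lerDl.
by apply: sumr_ge0 => j _; exact: sqr_ge0.
Qed.

Lemma sum_adj_loop (R : realType) (n d : nat) (E : graph n) (i : 'I_n) :
  (0 < d)%N -> E \in reg_graphs n d -> \sum_j adj_loop R E i j = d%:R.
Proof.
move=> d0; rewrite inE => /simple_regularP[nE _ dE].
under eq_bigr do rewrite mxE.
rewrite -natr_sum; congr (_%:R).
(* The self-loop adds one to the [d.-1] neighbours. *)
rewrite (bigD1 i) //= eqxx /= -(prednK d0) -(dE i) -sum1_card [in RHS]big_mkcond.
rewrite [in RHS](bigD1 i) //= inE (negbTE (nE i)) add0n add1n; congr _.+1.
apply: eq_bigr => j ji; rewrite inE eq_sym (negbTE ji) /=.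
by case: (_ \in _).
Qed.

Lemma adj_loop_sym (R : realType) (n d : nat) (E : graph n) (i j : 'I_n) :
  E \in reg_graphs n d -> adj_loop R E i j = adj_loop R E j i.
Proof.
by rewrite inE => /simple_regularP[_ sE _]; rewrite !mxE sE eq_sym.
Qed.

Lemma avg_matrixE (R : realType) (n d : nat) (E : graph n) (x : 'cV[R]_n) i :
  (avg_matrix R d E *m x) i 0 = d%:R^-1 * \sum_j adj_loop R E i j * x j 0.
Proof.
rewrite !mxE mulr_sumr; apply: eq_bigr => j _.
by rewrite [in LHS]mxE mulrA.
Qed.

(** By symmetry the columns of the adjacency matrix also sum to [d], so the averaging matrix is
    doubly stochastic. *)
Lemma mean_avg_matrix (R : realType) (n d : nat) (E : graph n) (x : 'cV[R]_n) :
  (0 < d)%N -> E \in reg_graphs n d -> mean (avg_matrix R d E *m x) = mean x.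
Proof.
move=> d0 EG; rewrite /mean; congr (_ * _).
under eq_bigr do rewrite avg_matrixE.
rewrite -mulr_sumr exchange_big /=.
under eq_bigr => j _.
  under eq_bigr do rewrite (adj_loop_sym _ _ _ EG).
  rewrite -mulr_suml (sum_adj_loop _ _ d0 EG).
  over.
by rewrite -mulr_sumr mulKf // pnatr_eq0 -lt0n.
Qed.

Lemma dev_avg_matrix (R : realType) (n d : nat) (E : graph n) (x : 'cV[R]_n) i :
  (0 < d)%N -> E \in reg_graphs n d ->
  (avg_matrix R d E *m x) i 0 - mean x =
  d%:R^-1 * \sum_j adj_loop R E i j * (x j 0 - mean x).
Proof.
move=> d0 EG; rewrite avg_matrixE.
under [in RHS]eq_bigr do rewrite mulrBr.
rewrite sumrB -mulr_suml (sum_adj_loop _ _ d0 EG) mulrBr mulKf //.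
by rewrite pnatr_eq0 -lt0n.
Qed.

Lemma sum_dev (R : realType) (n : nat) (x : 'cV[R]_n) :
  (0 < n)%N -> \sum_i (x i 0 - mean x) = 0.
Proof.
move=> n0; rewrite sumrB sumr_const card_ord -mulr_natl /mean mulVKf ?subrr //.
by rewrite pnatr_eq0 -lt0n.
Qed.

(** * Relabelling invariance and contraction in expectation *)

Definition relabel (n : nat) (p : {perm 'I_n}) (E : graph n) : graph n :=
  [set e | (p e.1, p e.2) \in E]%SET.

Lemma relabelK (n : nat) (p : {perm 'I_n}) :
  cancel (relabel p) (relabel p^-1)%g.
Proof. by move=> E; apply/setP => -[i j]; rewrite !inE /= !permKV. Qed.

Lemma reg_graphs_relabel (n d : nat) (p : {perm 'I_n}) (E : graph n) :
  (relabel p E \in reg_graphs n d) = (E \in reg_graphs n d).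
Proof.
have imp q F : F \in reg_graphs n d -> relabel q F \in reg_graphs n d.
  rewrite !inE => /simple_regularP[nF sF dF]; apply/simple_regularP; split.
  - by move=> i; rewrite inE nF.
  - by move=> i j; rewrite !inE /= sF.
  - move=> i; rewrite -(dF (q i)) -(card_imset _ (@perm_inj _ q)).
    apply: eq_card => j; rewrite inE; apply/imsetP/idP.
      by case=> k; rewrite !inE => h ->.
    by move=> h; exists ((q^-1)%g j); rewrite ?inE /= ?permKV.
by apply/idP/idP => [h|]; [rewrite -(relabelK p E)|]; exact: imp.
Qed.

(** Up to the factor [d ^ 2] times the number of graphs, this is the entry of the average of
    [P^T P]. *)
Definition codegree (R : realType) (n d : nat) (i j : 'I_n) : R :=
  \sum_(E in reg_graphs n d) \sum_k adj_loop R E k i * adj_loop R E k j.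

Lemma codegree_perm (R : realType) (n d : nat) (p : {perm 'I_n}) (i j : 'I_n) :
  codegree R d (p i) (p j) = codegree R d i j.
Proof.
rewrite [RHS]/codegree (reindex_inj (can_inj (relabelK p))) /=.
apply: eq_big => [E|E _]; first by rewrite reg_graphs_relabel.
rewrite (reindex_inj (@perm_inj _ p)) /=; apply: eq_bigr => k _.
by rewrite !mxE !inE /= !(inj_eq perm_inj).
Qed.

(** Two transpositions suffice: the first moves [i] to [i'] and [j] to [j1], the second moves [j1]
    to [j'] and fixes [i']. *)
Lemma codegree_const (R : realType) (n d : nat) (i j i' j' : 'I_n) :
  i != j -> i' != j' -> codegree R d i j = codegree R d i' j'.
Proof.
move=> ij ij'; pose j1 := tperm i i' j.
have i'j1 : i' != j1 by rewrite -(tpermL i i') (inj_eq perm_inj).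
rewrite -(codegree_perm _ _ (tperm i i')) tpermL -/j1.
by rewrite -(codegree_perm _ _ (tperm j1 j')) tpermL tpermD // eq_sym.
Qed.

Lemma codegree_diag (R : realType) (n d : nat) (i : 'I_n) : (0 < d)%N ->
  codegree R d i i = #|reg_graphs n d|%:R * d%:R.
Proof.
move=> d0; rewrite /codegree mulr_natl -sumr_const; apply: eq_bigr => E EG.
rewrite -(sum_adj_loop R i d0 EG); apply: eq_bigr => k _.
rewrite (adj_loop_sym _ _ _ EG) !mxE.
by case: (_ || _); rewrite ?mulr1 ?mulr0.
Qed.

Lemma codegree_ge0 (R : realType) (n d : nat) (i j : 'I_n) :
  0 <= codegree R d i j.
Proof.
apply: sumr_ge0 => E _; apply: sumr_ge0 => k _.
by rewrite !mxE mulr_ge0.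
Qed.

(* On vectors of sum zero the quadratic form of [a I + b (J - I)] is
   [(a - b) |y|^2]. *)
Lemma quad_form_le (R : realType) (n : nat) (Q : 'I_n -> 'I_n -> R)
    (y : 'I_n -> R) (a b : R) :
  (forall i, Q i i = a) -> (forall i j, i != j -> Q i j = b) -> 0 <= b ->
  \sum_i y i = 0 ->
  \sum_i \sum_j Q i j * (y i * y j) <= a * \sum_i y i ^+ 2.
Proof.
move=> Qd Qo b0 y0.
have -> : \sum_i \sum_j Q i j * (y i * y j) =
          b * (\sum_i y i) ^+ 2 + (a - b) * \sum_i y i ^+ 2.
  rewrite expr2 mulr_suml !mulr_sumr -big_split /=; apply: eq_bigr => i _.
  rewrite !mulr_sumr (bigD1 i) //= [in RHS](bigD1 i) //= Qd.
  under eq_bigr => j ji do rewrite Qo 1?eq_sym //.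
  ring.
rewrite y0 expr0n /= mulr0 add0r ler_wpM2r ?gerBl //.
by apply: sumr_ge0 => i _; exact: sqr_ge0.
Qed.

(** The left side is [d^-2] times the codegree form at the deviations, which sum to zero; only the
    diagonal, [d] per graph, survives in the bound. *)
Lemma sum_sqdev_avg (R : realType) (n d : nat) (x : 'cV[R]_n) :
  (0 < d)%N -> (0 < n)%N ->
  \sum_(E in reg_graphs n d) sqdev (avg_matrix R d E *m x) <=
  #|reg_graphs n d|%:R * (sqdev x / d%:R).
Proof.
move=> d0 n0; set y := fun i : 'I_n => x i 0 - mean x.
have dn0 : d%:R != 0 :> R by rewrite pnatr_eq0 -lt0n.
have -> : \sum_(E in reg_graphs n d) sqdev (avg_matrix R d E *m x) =
    d%:R^-1 ^+ 2 * \sum_i \sum_j codegree R d i j * (y i * y j).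
  transitivity (d%:R^-1 ^+ 2 * \sum_(E in reg_graphs n d) \sum_k \sum_i \sum_j
     adj_loop R E k i * adj_loop R E k j * (y i * y j)).
    rewrite mulr_sumr; apply: eq_bigr => E EG.
    rewrite /sqdev mean_avg_matrix // mulr_sumr; apply: eq_bigr => k _.
    rewrite dev_avg_matrix // exprMn; congr (_ * _).
    rewrite expr2 mulr_suml; apply: eq_bigr => i _.
    by rewrite mulr_sumr; apply: eq_bigr => j _; rewrite /y; ring.
  congr (_ * _).
  under eq_bigr => E _ do rewrite exchange_big /=.
  rewrite exchange_big /=; apply: eq_bigr => i _.
  under eq_bigr => E _ do rewrite exchange_big /=.
  rewrite exchange_big /=; apply: eq_bigr => j _.
  rewrite /codegree mulr_suml; apply: eq_bigr => E _.
  by rewrite mulr_suml.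
have [b b0 bP] : exists2 b : R, 0 <= b &
    forall i j : 'I_n, i != j -> codegree R d i j = b.
  case: (pickP (fun p : 'I_n * 'I_n => p.1 != p.2)) => [[i j] /= ij|none].
    exists (codegree R d i j); first exact: codegree_ge0.
    by move=> i' j' ij'; exact: codegree_const.
  by exists 0 => // i j ij; move: (none (i, j)); rewrite /= ij.
have /= := quad_form_le (fun i => codegree_diag R i d0) bP b0 (sum_dev x n0).
rewrite -/(sqdev x) => h.
apply: (le_trans (ler_wpM2l _ h)); first exact: sqr_ge0.
rewrite le_eqVlt; apply/orP; left; apply/eqP; by field.
Qed.

(** * Jensen's inequality for concave powers *)

Lemma powR_le_tangent (R : realType) (p w : R) : 0 < p -> p <= 1 -> 0 <= w ->
  w `^ p <= 1 + p * (w - 1).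
Proof.
move=> p0 p1; rewrite le_eqVlt => /predU1P[<-|w0].
  by rewrite powR0 ?gt_eqF //; lra.
rewrite /powR gt_eqF //; set a := p * ln w.
(* The bound [1 + z <= expR z] is used at [ln w - a] and at [- a]; the two consequences are combined
   with weights [p] and [1 - p]. *)
have -> : w = expR a * expR (ln w - a) by rewrite -expRD addrC subrK lnK.
have h1 := expR_ge1Dx (ln w - a).
have h2 : (1 - a) * expR a <= 1.
  by rewrite -ler_pdivlMr ?expR_gt0 // div1r -expRN; exact: expR_ge1Dx (- a).
have h3 : p * (expR a * (1 + (ln w - a))) <= p * (expR a * expR (ln w - a)).
  by rewrite ler_pM2l // ler_pM2l ?expR_gt0.
have h4 : p * (expR a * (1 + (ln w - a))) = expR a * (p + a * (1 - p)).
  by rewrite /a; ring.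
have h5 : 0 <= (1 - p) * (1 - (1 - a) * expR a) by rewrite mulr_ge0 // subr_ge0.
nra.
Qed.

(** For [m > 0] the tangent bound at [u i / m] is summed, its linear part being nonpositive in
    total. For [m <= 0] every [u i] with [i] in [A] vanishes. *)
Lemma sum_powR_le (R : realType) (I : finType) (A : {set I}) (u : I -> R)
    (p m : R) :
  0 < p -> p <= 1 -> (forall i, 0 <= u i) ->
  \sum_(i in A) u i <= #|A|%:R * m ->
  \sum_(i in A) u i `^ p <= #|A|%:R * m `^ p.
Proof.
move=> p0 p1 u0 um; have [A0|A0] := posnP #|A|.
  by rewrite (cards0_eq A0) big_set0 cards0 mul0r.
have [m0|m0] := ltP 0 m.
  have h i : u i `^ p <= m `^ p * (1 + p * (u i / m - 1)).
    have w0 : 0 <= u i / m by rewrite divr_ge0 // ltW.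
    have {1}-> : u i = m * (u i / m) by rewrite mulrCA divff ?mulr1 ?gt_eqF.
    by rewrite powRM ?(ltW m0) // ler_pM2l ?powR_gt0 //; exact: powR_le_tangent.
  apply: (le_trans (ler_sum _ (fun i _ => h i))).
  rewrite -mulr_sumr mulrC ler_wpM2r ?powR_ge0 //.
  rewrite big_split /= -mulr_sumr sumrB !sumr_const -mulr_suml gerDl.
  rewrite pmulr_rle0 // subr_le0 ler_pdivrMr //.
have s0 : \sum_(i in A) u i <= 0.
  by apply: (le_trans um); rewrite pmulr_rle0 // ltr0n.
rewrite big1 ?mulr_ge0 ?powR_ge0 // => i iA.
have -> : u i = 0.
  apply/eqP; rewrite eq_le u0 andbT; apply: le_trans s0.
  by rewrite (bigD1 i) //= lerDl; apply: sumr_ge0.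
by rewrite powR0 ?gt_eqF.
Qed.

(** * Sums over sequences of graphs and the first-step recursion *)

Definition scons (n : nat) (E : graph n) (g : nat -> graph n) (t : nat) :=
  if t is t'.+1 then g t' else E.

Definition extend (n T : nat) (gs : {ffun 'I_T -> graph n}) (t : nat) :=
  if insub t is Some i then gs i else finset.set0.

(** An expectation before division by the number of sequences. Padding with the empty graph matches
    [exp_partial_energy]. *)
Definition total (R : realType) (n d T : nat) (F : (nat -> graph n) -> R) : R :=
  \sum_(gs : {ffun 'I_T -> graph n} | [forall t, gs t \in reg_graphs n d])
    F (extend gs).

(** The first graph is split off, not the last, because the process then restarts from the averaged
    positions. *)
Lemma total_recl (R : realType) (n d T : nat) (F : (nat -> graph n) -> R) :
  total d T.+1 F =
  \sum_(E in reg_graphs n d) total d T (fun g => F (scons E g)).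
Proof.
pose h (p : graph n * {ffun 'I_T -> graph n}) : {ffun 'I_T.+1 -> graph n} :=
  [ffun t => if unlift ord0 t is Some t' then p.2 t' else p.1].
pose h' (gs : {ffun 'I_T.+1 -> graph n}) :=
  (gs ord0, [ffun t => gs (lift ord0 t)]).
have hK : cancel h h'.
  move=> [E gs]; rewrite /h' ffunE unlift_none; congr (_, _).
  by apply/ffunP => t; rewrite !ffunE liftK.
have h'K : cancel h' h.
  move=> gs; apply/ffunP => t; rewrite ffunE.
  by case: unliftP => [j|] -> //=; rewrite ffunE.
rewrite /total pair_big /= (reindex h) /=; last by exists h' => p _.
apply: eq_big => [[E gs]|[E gs] _] /=.
  apply/forallP/andP => [H|[EG /forallP H] t].
    split; first by have := H ord0; rewrite ffunE unlift_none.
    by apply/forallP => t; have := H (lift ord0 t); rewrite ffunE liftK.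
  by rewrite ffunE; case: unliftP.
congr F; apply/funext => -[|t].
  rewrite /extend; case: insubP => [i _ i0|//].
  by have -> : i = ord0; [exact: val_inj|rewrite ffunE unlift_none].
rewrite /extend /=; case: insubP => [i iT it|].
  case: insubP => [j jT jt|]; last by rewrite -ltnS iT.
  by have -> : i = lift ord0 j; [apply: val_inj; rewrite /= jt it|rewrite ffunE liftK].
by case: insubP => // j jT _; rewrite ltnS jT.
Qed.

Lemma total_cst (R : realType) (n d T : nat) (c : R) :
  total d T (fun _ : nat -> graph n => c) = #|reg_graphs n d|%:R ^+ T * c.
Proof.
elim: T => [|T IH].
  rewrite /total expr0 mul1r (bigD1 [ffun=> finset.set0]) /=; last first.
    by apply/forallP => -[].
  rewrite big1 ?addr0 // => gs /andP[_ /eqP ngs]; case: ngs.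
  by apply/ffunP => -[].
by rewrite total_recl sumr_const IH exprS -[LHS]mulr_natl mulrA.
Qed.

Lemma totalD (R : realType) (n d T : nat) (F F' : (nat -> graph n) -> R) :
  total d T (fun g => F g + F' g) = total d T F + total d T F'.
Proof. exact: big_split. Qed.

Definition energy (R : realType) (n d : nat) (s : R) (g : nat -> graph n)
    (x : 'cV[R]_n) (T : nat) : R :=
  \sum_(t < T) block_energy s (g t) (traj d g x t).

Lemma energy_scons (R : realType) (n d : nat) (s : R) (E : graph n) g
    (x : 'cV[R]_n) (T : nat) :
  energy d s (scons E g) x T.+1 =
  block_energy s E x + energy d s g (avg_matrix R d E *m x) T.
Proof.
rewrite /energy big_ord_recl /=; congr (_ + _); apply: eq_bigr => -[t tT] _ /=.
congr (block_energy s _ _); rewrite /bump /= => {tT}.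
by elim: t => //= t <-.
Qed.

Lemma exp_partial_energyE (R : realType) (n d : nat) (s : R) (x : 'cV[R]_n) T :
  exp_partial_energy d s x T =
  total d T.+1 (fun g => energy d s g x T.+1) / #|reg_graphs n d|%:R ^+ T.+1.
Proof.
rewrite /exp_partial_energy natrX; congr (_ / _); apply: eq_bigr => gs _.
rewrite -[RHS]/(partial_energy d s (extend gs) x T).
congr partial_energy; apply/funext => t; rewrite /extend; case: insubP => [i iT it|/negbTE -> //].
by rewrite iT; congr (gs _); apply: val_inj; rewrite /= inordK ?it.
Qed.

(** * The energy bound *)

Lemma sum_block_energy_le (R : realType) (n d : nat) (s : R) (x : 'cV[R]_n) :
  (1 < d)%N -> (0 < n)%N -> 0 < s -> s <= 1 ->
  \sum_(E in reg_graphs n d) block_energy s E x <=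
  #|reg_graphs n d|%:R * (6 * sqdev x `^ (s / 2)).
Proof.
move=> d1 n0 s0 s1; set v := Num.sqrt (sqdev x).
have v0 : 0 <= v by exact: sqrtr_ge0.
have xb i : mean x - v <= x i 0 <= mean x + v.
  have := norm_dev_le x i; rewrite -/v ler_norml => /andP[h1 h2].
  by apply/andP; split; lra.
(* Here [2 ^ s <= 2] as [s <= 1]; with three blocks on average this yields the constant 6. *)
have vs : (mean x + v - (mean x - v)) `^ s <= 2 * sqdev x `^ (s / 2).
  have -> : mean x + v - (mean x - v) = 2 * v by ring.
  rewrite powRM // (mulrC s) powRrM powR12_sqrt ?sqdev_ge0 // ler_wpM2r //.
    exact: powR_ge0.
  by rewrite -[leRHS]powRr1 // ler_powR // ler1n.
apply: (@le_trans _ _ (\sum_(E in reg_graphs n d)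
    #|closed_cuts E x|%:R * (2 * sqdev x `^ (s / 2)))).
  apply: ler_sum => E _; apply: (le_trans (block_energy_le E s0 xb)).
  by rewrite ler_wpM2l.
rewrite -mulr_suml -natr_sum.
have -> : #|reg_graphs n d|%:R * (6 * sqdev x `^ (s / 2)) =
  (3 * #|reg_graphs n d|)%:R * (2 * sqdev x `^ (s / 2)) by rewrite natrM; ring.
rewrite ler_wpM2r ?mulr_ge0 ?powR_ge0 // ler_nat.
exact: sum_card_closed_cuts.
Qed.

(** [C] is a supersolution of the one-step recursion: the first step costs 6 and the rest costs [C]
    times the contraction factor, in units of [V^(s/2)]. The induction needs all starting points at
    once. *)
Lemma total_energy_le (R : realType) (n d : nat) (s C : R) :
  (1 < d)%N -> (0 < n)%N -> 0 < s -> s <= 1 -> 0 <= C ->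
  6 + C * d%:R^-1 `^ (s / 2) <= C ->
  forall T (x : 'cV[R]_n), total d T (fun g => energy d s g x T) <=
    #|reg_graphs n d|%:R ^+ T * (C * sqdev x `^ (s / 2)).
Proof.
move=> d1 n0 s0 s1 C0 hC; set N := #|reg_graphs n d|%:R.
elim=> [|T IH] x.
  rewrite /total big1 ?mulr_ge0 ?powR_ge0 // => gs _.
  by rewrite /energy big_ord0.
rewrite total_recl.
apply: (@le_trans _ _ (\sum_(E in reg_graphs n d) (N ^+ T * block_energy s E x +
   N ^+ T * (C * sqdev (avg_matrix R d E *m x) `^ (s / 2))))).
  apply: ler_sum => E _.
  have -> : (fun g => energy d s (scons E g) x T.+1) =
      (fun g => block_energy s E x + energy d s g (avg_matrix R d E *m x) T).
    by apply/funext => g; rewrite energy_scons.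
  by rewrite totalD total_cst lerD2l.
rewrite big_split /= -!mulr_sumr -mulrDr exprSr -mulrA ler_wpM2l ?exprn_ge0 //.
have h1 := sum_block_energy_le x d1 n0 s0 s1.
have h2 : \sum_(E in reg_graphs n d)
     sqdev (avg_matrix R d E *m x) `^ (s / 2) <= N * (sqdev x / d%:R) `^ (s / 2).
  apply: sum_powR_le; [lra|lra|by move=> E; exact: sqdev_ge0|].
  by apply: sum_sqdev_avg => //; exact: ltnW.
rewrite powRM ?sqdev_ge0 // in h2.
apply: (le_trans (lerD h1 (ler_wpM2l C0 h2))); rewrite -/N.
set V := sqdev x `^ _ in h1 h2 *; set q := _^-1 `^ _ in hC h2 *.
have -> : N * (6 * V) + C * (N * (V * q)) = N * ((6 + C * q) * V) by ring.
by rewrite ler_wpM2l // ler_wpM2r // powR_ge0.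
Qed.

Theorem theorem1 (R : realType) (d : nat) (hd : (3 < d)%N) :
  exists c : R, 0 < c /\
    forall (n : nat), (d < n)%N ->
      (0 < #|reg_graphs n d|)%N ->
      forall s : R, 0 < s -> s <= 1 ->
      forall x0 : 'cV[R]_n,
        \sum_(i < n) d%:R * (x0 i 0 - mean x0) ^+ 2 <= 1 ->
        (expected_energy d s x0 <= (c / s)%:E)%E.
Proof.
have d1 : (1 < d)%N by apply: leq_trans hd.
have dR : 1 < d%:R :> R by rewrite ltr1n.
have dR0 : 0 < d%:R :> R by apply: lt_trans dR.
(* Chosen so that the contraction factor [d^(-s/2)] is [expR (- (s * L))]. *)
pose L : R := ln d%:R / 2.
have L0 : 0 < L by rewrite divr_gt0 // ln_gt0.
exists (6 * (1 + L) / L); split; first by rewrite divr_gt0 // mulr_gt0 //; lra.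
move=> n dn N0 s s0 s1 x0 hx.
have n0 : (0 < n)%N by apply: leq_trans dn.
have V1 : sqdev x0 `^ (s / 2) <= 1.
  have V1 : sqdev x0 <= 1.
    rewrite -mulr_sumr in hx; apply: le_trans hx.
    by rewrite ler_peMl ?sqdev_ge0 // ltW.
  have p1 : 1 `^ (s / 2) = 1 :> R by rewrite powR1.
  rewrite -[leRHS]p1; apply: ge0_ler_powR => //; first lra.
  - by rewrite nnegrE sqdev_ge0.
  - by rewrite nnegrE.
(* The geometric sum [6 / (1 - expR (- (s * L)))] is at most [6 * (1 + s * L) / (s * L)], hence at
   most [C] since [s <= 1]. *)
set C := 6 * (1 + L) / L / s.
have C0 : 0 <= C by apply: divr_ge0 (ltW s0); apply: divr_ge0 (ltW L0); lra.
have sL : 0 < s * L by rewrite mulr_gt0.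
have hC : 6 + C * d%:R^-1 `^ (s / 2) <= C.
  have -> : d%:R^-1 `^ (s / 2) = (expR (s * L))^-1.
    rewrite -expRN -(powR_inv1 (ltW dR0)) -powRrM /powR gt_eqF //; congr expR.
    by rewrite /L; field.
  have h1 := expR_ge1Dx (s * L).
  have h2 : (expR (s * L))^-1 <= (1 + s * L)^-1.
    by rewrite lef_pV2 // posrE ?expR_gt0 //; lra.
  apply: (@le_trans _ _ (6 + C * (1 + s * L)^-1)).
    by rewrite lerD2l ler_wpM2l.
  have -> : C * (1 + s * L)^-1 = C - C * (s * L) / (1 + s * L).
    by field; rewrite gt_eqF //; lra.
  have -> : C * (s * L) = 6 * (1 + L) by rewrite /C; field; rewrite !gt_eqF.
  suff : 6 <= 6 * (1 + L) / (1 + s * L) by lra.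
  rewrite ler_pdivlMr ?ler_pM2l ?lerD2l ?ler_piMl //; lra.
apply: ge_ereal_sup => _ [T _ <-]; rewrite lee_fin exp_partial_energyE.
have NT : 0 < #|reg_graphs n d|%:R ^+ T.+1 :> R by rewrite exprn_gt0 // ltr0n.
rewrite ler_pdivrMr // mulrC.
apply: (le_trans (total_energy_le d1 n0 s0 s1 C0 hC _ _)).
by rewrite ler_pM2l // ler_piMr.
Qed.
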